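(* Let $N\in\mathbb{N}$ and let $\tilde W=(\tilde w_{i,j})\in(\mathbb{R}_0^+)^{N\times N}$ be a constant weight matrix. Among $N$ initially distinct positions $v_i\in(0,1)$ evolving according to $$\partial_t v_i=\sum_{j\in J_2^i}\tilde w_{i,j}\,\Phi(v_j-v_i)-\sum_{j=1}^N\tilde w_{i,j}\,\Phi(v_j+v_i),\qquad i=1,\ldots,N,$$ no two ever become equal if $\tilde w_{j,k}=\tilde w_{i,k}>0$ for $1\le i,j,k\le N$, $i\neq j$.
   Context: $J_2^i:=\{j\in\{1,\ldots,N\}\mid v_j\neq v_i\}$ (depending on the current positions). Penaliser and flux: $\Psi:\mathbb{R}_0^+\to\mathbb{R}$ is such that $s\mapsto\Psi(s^2)$ is continuously differentiable, decreasing and strictly convex on $[0,1]$, with $\Psi(0)=0$ and vanishing left-sided derivative at $s=1$. It is extended to $[-1,1]$ by symmetry (evenness) and to $\mathbb{R}$ by periodicity $\Psi((2+s)^2)=\Psi(s^2)$. The flux is $\Phi(s):=\Psi'(s^2)\,s$, i.e. half the derivative of $s\mapsto\Psi(s^2)$, defined for $s$ not an even integer. Hence $\Phi(-s)=-\Phi(s)$, $\Phi(2+s)=\Phi(s)$, $\Phi$ is continuous and increasing on $(0,2)$, $\Phi(1)=0$, and $\Phi$ has jump discontinuities at the even integers. *)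

(* Defs.v *)
From HB Require Import structures.
From mathcomp Require Import all_boot all_order all_algebra.
From mathcomp Require Import all_classical all_reals all_analysis.

Set Implicit Arguments.
Unset Strict Implicit.
Unset Printing Implicit Defensive.

Import Order.TTheory GRing.Theory Num.Theory.
Import numFieldNormedType.Exports.

Local Open Scope classical_set_scope.
Local Open Scope ring_scope.

(* One-sided derivatives at the end points of D when D is an interval. *)
Definition derivative_within (R : realType) (D : set R) (f : R -> R) (x d : R) :=
  (fun y => (f y - f x) / (y - x)) @ within D x^' --> d.

Definition C1_on (R : realType) (D : set R) (f : R -> R) :=
  exists2 f' : R -> R,
    {within D, continuous f'} & forall x, D x -> derivative_within D f x (f' x).

Definition strictly_convex_on (R : realType) (D : set R) (f : R -> R) :=
  forall x y t : R, D x -> D y -> x != y -> 0 < t < 1 ->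
    f ((1 - t) * x + t * y) < (1 - t) * f x + t * f y.

(* Psi is mathematically a function on [0, +oo[; its values at negative
   arguments are unconstrained and play no role. Evenness of s |-> Psi (s ^+ 2)
   is automatic. *)
Record penaliser (R : realType) (Psi : R -> R) : Prop := Penaliser {
  penaliser_C1 : C1_on `[0, 1] (fun s => Psi (s ^+ 2)) ;
  penaliser_decreasing :
    {in `[0, 1] &, {homo (fun s => Psi (s ^+ 2)) : x y / x < y >-> y < x}} ;
  penaliser_convex : strictly_convex_on `[0, 1] (fun s => Psi (s ^+ 2)) ;
  penaliser0 : Psi 0 = 0 ;
  penaliser_left_derivative1 :
    (fun s => (Psi (s ^+ 2) - Psi 1) / (s - 1)) @ 1^'- --> (0 : R) ;
  penaliser_periodic : forall s : R, Psi ((2 + s) ^+ 2) = Psi (s ^+ 2)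
}.

(* Meaningful only when s is not an even integer, where Psi is differentiable
   at s ^+ 2 for a penaliser Psi. *)
Definition flux (R : realType) (Psi : R -> R) (s : R) : R :=
  derive1 Psi (s ^+ 2) * s.

Definition velocity (R : realType) (N : nat) (W : 'M[R]_N) (Psi : R -> R)
    (x : 'I_N -> R) (i : 'I_N) : R :=
  \sum_(j < N | x j != x i) W i j * flux Psi (x j - x i)
  - \sum_(j < N) W i j * flux Psi (x j + x i).

(* v i t is the i-th position at time t; the time interval J is meant to start
   at 0 and may be open or closed at its end, bounded or not. At the end points
   of J only continuity is required. *)
Definition evolves (R : realType) (N : nat) (W : 'M[R]_N) (Psi : R -> R)
    (J : interval R) (v : 'I_N -> R -> R) : Prop :=
  (forall i, {within [set` J], continuous (v i)}) /\
  (forall i t, [set` J]^° t ->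
     is_derive t 1 (v i) (velocity W Psi (fun j => v j t) i)).

(* Main.v *)
(** A gap between two positions cannot close because the repulsion of the pair
    itself, of size at least [c = - Phi(0+) > 0] times a weight, dominates.  When
    [v_b - v_a] is small, any third position contributes to the derivative of
    the gap almost nothing if it lies outside [[v_a, v_b]] (uniform continuity
    of the flux on [(0, 2)], which survives up to the end points) and a positive
    amount if it lies inside.  Hence the derivative of the gap is positive
    whenever the gap is small, and no minimal gap or simultaneous collision has
    to be singled out.

    The weights being the same for all positions, all of them follow one
    velocity field, and this field vanishes at 0 and 1.  The end points of the
    unit interval thus behave like motionless particles, so that the confinement
    of the positions to [(0, 1)] is another instance of the absence of
    collisions. *)
Require Import Defs.
From HB Require Import structures.
From mathcomp Require Import all_boot all_order all_algebra.
From mathcomp Require Import all_classical all_reals all_analysis.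
From mathcomp Require Import ring lra.

Set Implicit Arguments.
Unset Strict Implicit.
Unset Printing Implicit Defensive.

Import Order.TTheory GRing.Theory Num.Theory.
Import numFieldNormedType.Exports.

Local Open Scope classical_set_scope.
Local Open Scope ring_scope.

(** * Uniform continuity and a barrier principle *)

Lemma within_continuous_ball (R : realType) (A : set R) (f : R -> R) (x e : R) :
  {within A, continuous f} -> A x -> 0 < e ->
  exists2 d : R, 0 < d & forall y, A y -> `|x - y| < d -> `|f x - f y| < e.
Proof.
move=> /subspace_continuousP fA Ax e0.
have /cvgrPdist_lt /(_ _ e0) := fA x Ax.
rewrite near_withinE => /nbhs_ballP[d /= d0 dP].
by exists d => // y Ay xy; exact: dP.
Qed.

Lemma compact_uniform_continuity (R : realType) (K : set R) (f : R -> R) (e : R) :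
  compact K -> {within K, continuous f} -> 0 < e ->
  exists2 d : R, 0 < d &
    forall x y, K x -> K y -> `|x - y| < d -> `|f x - f y| < e.
Proof.
move=> /compact_near_coveringP cK fK e0.
pose P (d x : R) := K x -> forall y, K y -> `|x - y| < d -> `|f x - f y| < e.
have : \forall d \near (0 : R)^'+, K `<=` P d.
  apply: cK => x Kx.
  have [d d0 dP] := within_continuous_ball fK Kx (divr_gt0 e0 (ltr0n _ 2)).
  exists (ball x (d / 2), [set r | r < d / 2]) => /=.
    split; first by apply: nbhsx_ballx; lra.
    by apply: nbhs_right_lt; lra.
  move=> [z r] /= [xz rd] Kz y Ky zy.
  rewrite /ball /= in xz.
  have xy : `|x - y| < d by have := ler_distD z x y; lra.
  have xz' : `|x - z| < d by lra.
  have := dP y Ky xy; have := dP z Kz xz'.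
  by have := ler_distD (f x) (f z) (f y); rewrite (distrC (f z) (f x)); lra.
move=> H.
have [d [d0 dP]] : exists d : R, 0 < d /\ K `<=` P d.
  near (0 : R)^'+ => d; exists d; split; near: d; last exact: H.
  exact: nbhs_right_gt.
by exists d => // x y Kx Ky; exact: dP.
Unshelve. all: by end_near. Qed.

(** At the first time [t0] where some [g k] fails to be positive, continuity puts that [g k] below
    its threshold [d] just before [t0], while the whole family is still positive. It then increases
    up to [t0] from a positive value, which is absurd. *)
Lemma barrier (R : realType) (K : finType) (Q : pred K) (g : K -> R -> R) (T : R)
    (g_cont : forall k, Q k -> {within `[0, T], continuous (g k)})
    (g_init : forall k, Q k -> 0 < g k 0)
    (g_repel : forall k, Q k -> exists2 d : R, 0 < d & forall t, 0 < t < T ->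
      (forall l, Q l -> 0 < g l t) -> g k t < d ->
      exists2 D : R, is_derive t 1 (g k) D & 0 < D) :
  forall k t, Q k -> 0 <= t <= T -> 0 < g k t.
Proof.
move=> k1 t1 Qk1 t1T; rewrite ltNge; apply/negP => gk1.
pose A := [set s | 0 <= s <= T /\ exists2 k, Q k & g k s <= 0].
have At1 : A t1 by split=> //; exists k1.
have A0 : lbound A 0 by move=> s [/andP[]].
have lbA : has_lbound A by exists 0.
pose t0 := inf A.
have t00 : 0 <= t0 by apply: lb_le_inf => //; exists t1.
have t0T : t0 <= T by apply: le_trans (ge_inf lbA At1) _; case/andP: t1T.
have T0 : `[0, T]%classic t0 by rewrite /= in_itv /= t00.
have before s : 0 <= s < t0 -> forall k, Q k -> 0 < g k s.
  move=> /andP[s0 st0] k Qk; rewrite ltNge; apply/negP => gs.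
  have : t0 <= s.
    by apply: ge_inf => //; split; [rewrite s0 ltW// (lt_le_trans st0)|exists k].
  by rewrite leNgt st0.
(* The infimum is attained: as [K] is finite, positivity of all the [g k] at [t0] would persist on a
   common neighbourhood. *)
have [k Qk gk] : exists2 k, Q k & g k t0 <= 0.
  apply: contrapT => noneg.
  have pos k : Q k -> 0 < g k t0.
    by move=> Qk; rewrite ltNge; apply/negP => gk; apply: noneg; exists k.
  have [d d0 dP] : exists2 d : R, 0 < d & forall k s, Q k -> 0 <= s <= T ->
      `|t0 - s| < d -> 0 < g k s.
    have : \forall d \near (0 : R)^'+, forall k, Q k -> forall s, 0 <= s <= T ->
        `|t0 - s| < d -> 0 < g k s.
      apply: filter_forall => k.
      have [Qk|nQk] := boolP (Q k); last exact: nearW.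
      have [e e0 eP] := within_continuous_ball (g_cont k Qk) T0 (pos k Qk).
      near=> d => _ s sT std.
      have : `|g k t0 - g k s| < g k t0.
        apply: eP; first by rewrite /= in_itv.
        by apply: lt_trans std _; near: d; exact: nbhs_right_lt.
      by move=> /ltr_normlP[_]; lra.
    move=> H; near (0 : R)^'+ => d; exists d; first by near: d; exact: nbhs_right_gt.
    move=> k s Qk; move: k Qk s; near: d; exact: H.
  have [s As sd] := inf_adherent d0 (conj (ex_intro _ t1 At1) lbA : has_inf A).
  have t0s : t0 <= s := ge_inf lbA As.
  case: As => sT [k Qk]; apply/negP; rewrite -ltNge; apply: dP => //.
  by rewrite distrC ger0_norm ?subr_ge0//; rewrite -/t0 in sd; lra.
have t0_gt0 : 0 < t0.
  rewrite lt_neqAle t00 andbT; apply/eqP => t0E.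
  by move: gk; rewrite -t0E leNgt g_init.
have [d d0 dP] := g_repel k Qk.
have [e e0 eP] := within_continuous_ball (g_cont k Qk) T0 d0.
(* Late enough for [g k] to stay below [d] from [s] to [t0], yet positive. *)
pose s := Num.max (t0 / 2) (t0 - e / 2).
have st0 : s < t0 by rewrite gt_max; lra.
have [s0 se] : t0 / 2 <= s /\ t0 - e / 2 <= s by rewrite !le_max !lexx orbT.
have pull u : s <= u < t0 -> exists2 D : R, is_derive u 1 (g k) D & 0 < D.
  move=> /andP[su ut0]; apply: dP; [lra|by apply: before; lra|].
  have : `|g k t0 - g k u| < d.
    apply: eP; first by rewrite /= in_itv /=; lra.
    by rewrite ger0_norm; lra.
  by move=> /ltr_normlP[]; lra.
have [||c] := @MVT R (g k) (fun u => 'D_1 (g k) u) s t0 st0.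
- move=> u; rewrite in_itv /= => /andP[su ut0].
  by have [|D gD _] := pull u; [lra|exact: DeriveDef].
- apply: continuous_subspaceW (g_cont k Qk) => u /=; rewrite !in_itv /=; lra.
rewrite in_itv /= => /andP[sc ct0].
have [|D gD D0] := pull c; first lra.
have -> : 'D_1 (g k) c = D by exact: derive_val.
have gs : 0 < g k s by apply: before => //; lra.
move=> E; have : 0 < D * (t0 - s) by rewrite mulr_gt0 // subr_gt0.
by lra.
Unshelve. all: by end_near. Qed.

(** * The flux as half a derivative, and its modulus of continuity *)

Lemma is_derive_eps (R : realType) (f : R -> R) (x l : R) :
  (forall e : R, 0 < e -> exists2 d : R, 0 < d & forall h : R, h != 0 ->
     `|h| < d -> `|(f (h + x) - f x) / h - l| < e) ->
  is_derive x 1 f l.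
Proof.
move=> fP.
have fl : (fun h => h^-1 *: ((f \o shift x) (h *: 1) - f x)) @ 0^' --> l.
  apply/cvgrPdist_lt => e /fP[d d0 dP].
  rewrite near_withinE; apply/nbhs_ballP; exists d => //= h.
  rewrite /ball /= sub0r normrN => hd h0.
  have := dP h h0 hd.
  by rewrite distrC /= [h *: 1]mulr1 [_ *: _]mulrC.
by apply: DeriveDef; [exact: cvgP fl|exact: cvg_lim fl].
Qed.

Lemma derivative_within_itv (R : realType) (a b : R) (f : R -> R) (x l : R) :
  derivative_within `[a, b] f x l -> a < x < b -> is_derive x 1 f l.
Proof.
move=> /cvgrPdist_lt fl /andP[ax xb].
apply: is_derive_eps => e /fl.
rewrite near_withinE /dnbhs near_withinE => /nbhs_ballP[d /= d0 dP].
exists (Num.min d (Num.min (x - a) (b - x))); first by rewrite !lt_min d0; lra.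
move=> h h0; rewrite !lt_min => /and3P[hd ha hb].
have := dP (h + x); rewrite /ball /= opprD addrCA subrr addr0 normrN addrK distrC.
apply=> //; first by rewrite -subr_eq0 addrK.
have := ler_norm h; have := ler_norm (- h); rewrite normrN in_itv /=; lra.
Qed.

(** Near [s ^+ 2], [Psi] is [u |-> Psi (u ^+ 2)] composed with the square root, whose derivative
    [(2 * s)^-1] absorbs the factor [s] of the flux. *)
Lemma flux_is_derive (R : realType) (Psi : R -> R) (s d : R) : 0 < s ->
  is_derive s 1 (fun u => Psi (u ^+ 2)) d -> flux Psi s = d / 2.
Proof.
move=> s0 Pd; have s2 : 0 < s ^+ 2 by rewrite exprn_gt0.
have sE : Num.sqrt (s ^+ 2) = s by rewrite sqrtr_sqr gtr0_norm.
have : is_derive (s ^+ 2) 1 Psi (d * (2 * s)^-1).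
  apply: (@near_eq_is_derive _ _ _ ((fun u => Psi (u ^+ 2)) \o Num.sqrt)).
    by apply: filterS (lt_nbhsr s2) => u u0; rewrite /= sqr_sqrtr// ltW.
  apply: is_derive1_comp; first by rewrite sE.
  by rewrite -{2}sE; exact: is_derive1_sqrt.
move=> Psi_d; rewrite /flux derive1E derive_val.
by field; rewrite gt_eqF.
Qed.

Lemma fluxN (R : realType) (Psi : R -> R) (s : R) : flux Psi (- s) = - flux Psi s.
Proof. by rewrite /flux sqrrN mulrN. Qed.

Lemma penaliser_reflect (R : realType) (Psi : R -> R) (s : R) :
  penaliser Psi -> Psi ((2 - s) ^+ 2) = Psi (s ^+ 2).
Proof. by move=> Psi_pen; rewrite penaliser_periodic// sqrrN. Qed.

(* The prescribed left derivative is two-sided by reflection; without this,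
   [flux Psi 1] would be a junk value. *)
Lemma penaliser_derive1 (R : realType) (Psi : R -> R) :
  penaliser Psi -> is_derive (1 : R) 1 (fun s => Psi (s ^+ 2)) 0.
Proof.
move=> Psi_pen; pose h s := Psi (s ^+ 2).
have h_reflect s : h (2 - s) = h s by exact: penaliser_reflect.
apply: is_derive_eps => e e0.
have /cvgrPdist_lt/(_ _ e0) := penaliser_left_derivative1 Psi_pen.
rewrite near_withinE => /nbhs_ballP[d /= d0 dP]; exists d => // u u0 ud.
have left (y : R) : 0 < y -> y < d -> `|(h (1 - y) - h 1) / - y - 0| < e.
  move=> y0 yd; have := dP (1 - y).
  rewrite /ball /= opprB addrCA subrr addr0 gtr0_norm// => /(_ yd) /=.
  rewrite distrC /h expr1n addrAC subrr add0r => H; apply: H; lra.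
(* By reflection, the quotient at [u > 0] is the opposite of the one at [- u]. *)
have [ug|ul|/eqP] := ltgtP 0 u; last by rewrite eq_sym (negPf u0).
- rewrite gtr0_norm// in ud; have := left _ ug ud.
  have -> : h (1 - u) = h (u + 1) by rewrite -h_reflect; congr h; ring.
  by rewrite invrN mulrN !subr0 normrN.
- rewrite ltr0_norm// in ud; have := left (- u).
  by rewrite opprK oppr_gt0 [1 + u]addrC => /(_ ul ud).
Qed.

(** The function [s |-> Psi (s ^+ 2)] is symmetric about 1, so its derivative is odd about 1. *)
Lemma flux_reflect (R : realType) (Psi : R -> R) (s : R) :
  penaliser Psi -> 0 < s < 2 -> flux Psi (2 - s) = - flux Psi s.
Proof.
move=> Psi_pen; pose h s := Psi (s ^+ 2).
have h_derive1 : is_derive (1 : R) 1 h 0 by exact: penaliser_derive1.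
have [h' _ h'P] := penaliser_C1 Psi_pen.
have half u : 0 < u -> u <= 1 -> flux Psi (2 - u) = - flux Psi u.
  move=> u0 u1.
  have [D hD] : exists D, is_derive u 1 h D.
    move: u1; rewrite le_eqVlt => /predU1P[->|u1]; first by exists 0.
    exists (h' u); apply: (@derivative_within_itv _ 0 1); last by rewrite u0.
    by apply: h'P; rewrite /= in_itv /=; lra.
  have hD' : is_derive (2 - u) 1 h (- D).
    rewrite (_ : h = h \o (fun s => 2 - s)); last first.
      by apply/funext => y; rewrite /h /= penaliser_reflect.
    rewrite -[- D]mulrN1; apply: is_derive1_comp.
      by rewrite (_ : 2 - (2 - u) = u)//; ring.
    by rewrite -[-1]sub0r; exact: is_deriveB.
  by rewrite (flux_is_derive u0 hD) (flux_is_derive _ hD'); lra.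
move=> /andP[s0 s2]; have [s1|s1] := leP s 1; first exact: half.
rewrite -[in RHS](_ : 2 - (2 - s) = s); last ring.
by rewrite (half (2 - s)) ?opprK//; lra.
Qed.

Lemma flux_half_derivative (R : realType) (Psi : R -> R) :
  penaliser Psi -> exists2 h' : R -> R, {within `[0, 1], continuous h'} &
    (forall s, 0 < s <= 1 -> flux Psi s = h' s / 2) /\ h' 0 < 0.
Proof.
move=> Psi_pen; pose h s := Psi (s ^+ 2).
have h_derive1 : is_derive (1 : R) 1 h 0 by exact: penaliser_derive1.
have [h' h'_cont h'P] := penaliser_C1 Psi_pen.
(* The derivative within [[0, 1]] at 1 and the left derivative are limits of the same quotient. *)
have h'1 : h' 1 = 0.
  pose q y := (h y - h 1) / (y - 1).
  have qh : q @ 1^'- --> h' 1.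
    have h1 : `[0, 1]%classic (1 : R) by rewrite /= in_itv /= ler01 lexx.
    apply: cvg_trans (h'P 1 h1) => P.
    rewrite /= !near_simpl !near_withinE => /nbhs_ballP[d /= d0 dP].
    apply/nbhs_ballP; exists (Num.min d 1); first by rewrite /= lt_min d0 ltr01.
    move=> y; rewrite /ball /= lt_min => /andP[yd y1] ylt1; apply: dP => //.
      by rewrite lt_eqF.
    have := ler_norm (1 - y); rewrite in_itv /=; lra.
  have q0 : q @ 1^'- --> (0 : R).
    by have := penaliser_left_derivative1 Psi_pen; rewrite /q /h expr1n.
  by rewrite -(cvg_lim _ qh)//; exact: cvg_lim q0.
exists h' => //; split=> [s /andP[s0 s1]|].
  move: s1; rewrite le_eqVlt => /predU1P[->|s1].
    by rewrite (flux_is_derive ltr01 h_derive1) h'1.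
  apply: flux_is_derive => //; apply: (@derivative_within_itv _ 0 1); last by rewrite s0.
  by apply: h'P; rewrite /= in_itv /=; lra.
have h10 : h 1 < h 0.
  by apply: (penaliser_decreasing Psi_pen); rewrite ?in_itv /= ?lexx ?ler01 ?ltr01.
(* Strict convexity keeps the slope of the chord from 0 to [y] below [h 1 - h 0 < 0], whereas
   [0 <= h' 0] would force it above for small [y]. *)
rewrite ltNge; apply/negP => h'0.
have h0 : `[0, 1]%classic (0 : R) by rewrite /= in_itv /= ler01 lexx.
have /cvgrPdist_lt/(_ (h 0 - h 1)) := h'P 0 h0.
rewrite subr_gt0 => /(_ h10).
rewrite near_withinE /dnbhs near_withinE => /nbhs_ballP[d /= d0 dP].
pose y := Num.min (d / 2) (1 / 2).
have y0 : 0 < y by rewrite lt_min; lra.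
have [yd y1] : y <= d / 2 /\ y <= 1 / 2 by rewrite !ge_min !lexx orbT.
have := dP y; rewrite /ball /= !subr0 sub0r normrN gtr0_norm//.
rewrite gt_eqF// in_itv /= => /(_ ltac:(lra) isT ltac:(lra)) /ltr_normlP[_].
have : (h y - h 0) / y < h 1 - h 0.
  rewrite ltr_pdivrMr//.
  have h1 : `[0, 1]%classic (1 : R) by rewrite /= in_itv /= ler01 lexx.
  have y01 : 0 < y < 1 by lra.
  have := penaliser_convex Psi_pen h0 h1; rewrite eq_sym oner_eq0 => /(_ y isT y01).
  by rewrite mulr0 add0r mulr1 -!/(h _); lra.
by rewrite /h; lra.
Qed.

(** Here [- c] is the limit of the flux at 0 from the right. The flux is half of [h'], which is
    continuous up to 0, and reflection about 1 carries this over to the other half of [(0, 2)]. *)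
Lemma flux_modulus (R : realType) (Psi : R -> R) : penaliser Psi ->
  exists2 c : R, 0 < c & forall e : R, 0 < e -> exists2 d : R, 0 < d &
    (forall s, 0 < s < d -> `|flux Psi s + c| < e) /\
    (forall s u, 0 < s < 2 -> 0 < u < 2 -> `|s - u| < d ->
       `|flux Psi s - flux Psi u| < e).
Proof.
move=> Psi_pen.
have [h' h'_cont [fluxE h'0]] := flux_half_derivative Psi_pen.
have h'1 : h' 1 = 0.
  have := @flux_reflect _ _ 1 Psi_pen; rewrite (_ : 2 - 1 = 1); last ring.
  by rewrite fluxE; lra.
(* As [h' 1 = 0], the odd extension of [h'] about 1 is a difference of two
   truncations, so no gluing at 1 is needed. *)
pose m s : R := h' (Num.min s 1).
have fluxE2 s : 0 < s < 2 -> flux Psi s = (m s - m (2 - s)) / 2.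
  move=> s02; rewrite /m; have [s1|s1] := leP s 1.
    by rewrite min_r ?h'1 ?fluxE; lra.
  rewrite min_l; last by lra.
  have := flux_reflect Psi_pen s02; rewrite fluxE ?h'1; lra.
exists (- h' 0 / 2); first by lra.
move=> e e0.
have [d d0 dP] := compact_uniform_continuity (@segment_compact R 0 1) h'_cont e0.
have mP s u : 0 < s -> 0 < u -> `|s - u| < d -> `|m s - m u| < e.
  move=> s0 u0 su; apply: dP.
  - by rewrite /= in_itv /= le_min ge_min lexx orbT andbT; lra.
  - by rewrite /= in_itv /= le_min ge_min lexx orbT andbT; lra.
  - apply: le_lt_trans su; rewrite ler_norml.
    have := ler_norm (s - u); have := ler_norm (- (s - u)); rewrite normrN.
    by have [] := leP s 1; have [] := leP u 1; lra.
(* The bound 1 keeps [s] where the flux is [h' s / 2]. *)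
exists (Num.min d 1); first by rewrite lt_min d0 ltr01.
split=> [s|s u s02 u02].
  rewrite lt_min => /and3P[s0 sd s1]; rewrite fluxE; last by lra.
  have : `|h' s - h' 0| < e.
    by apply: dP; rewrite /= ?in_itv /= ?subr0 ?gtr0_norm//; lra.
  rewrite !ltr_norml; lra.
rewrite lt_min => /andP[su _]; rewrite !fluxE2//.
have : `|m s - m u| < e by apply: mP => //; lra.
have : `|m (2 - s) - m (2 - u)| < e.
  have E : 2 - s - (2 - u) = - (s - u) by ring.
  by apply: mP; rewrite ?E ?normrN//; lra.
rewrite !ltr_norml; lra.
Qed.

(** * The common velocity field and the spreading of small gaps *)

(* The velocity at an arbitrary place [y]; at a particle the excluded terms
   vanish anyway, since [flux Psi 0 = 0] by definition. *)
Definition drift (R : realType) (N : nat) (Psi : R -> R) (w x : 'I_N -> R) (y : R) : R :=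
  \sum_(k < N) w k * (flux Psi (x k - y) - flux Psi (x k + y)).

Lemma velocity_drift (R : realType) (N : nat) (W : 'M[R]_N) (Psi : R -> R)
    (x : 'I_N -> R) (i : 'I_N) :
  velocity W Psi x i = drift Psi (W i) x (x i).
Proof.
rewrite /velocity /drift big_mkcond -sumrB; apply: eq_bigr => j _ /=.
rewrite mulrBr; case: eqP => //= ->.
by rewrite subrr /flux mulr0 mulr0.
Qed.

Lemma drift0 (R : realType) (N : nat) (Psi : R -> R) (w x : 'I_N -> R) :
  drift Psi w x 0 = 0.
Proof. by apply: big1 => k _; rewrite subr0 addr0 subrr mulr0. Qed.

(** The arguments [1 - x k] and [x k + 1] add up to 2, so oddness and reflection make the two flux
    terms of each particle equal. *)
Lemma drift1 (R : realType) (N : nat) (Psi : R -> R) (w x : 'I_N -> R) :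
  penaliser Psi -> (forall k, 0 < x k < 1) -> drift Psi w x 1 = 0.
Proof.
move=> Psi_pen x01; apply: big1 => k _; have xk := x01 k.
rewrite -[x k - 1]opprB fluxN -flux_reflect//; last by lra.
by rewrite (_ : 2 - (1 - x k) = x k + 1) ?subrr ?mulr0//; ring.
Qed.

(* [a] or [b] may be a wall (0 or 1) instead of a particle. *)
Lemma drift_spread (R : realType) (N : nat) (Psi : R -> R) (w : 'I_N -> R)
    (i : 'I_N) :
  penaliser Psi -> (forall k, 0 <= w k) -> 0 < w i ->
  exists2 d : R, 0 < d & forall (x : 'I_N -> R) (a b : R),
    (forall k, 0 < x k < 1) -> 0 <= a -> b <= 1 -> 0 < b - a < d ->
    x i = a \/ x i = b -> drift Psi w x a < drift Psi w x b.
Proof.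
move=> Psi_pen w0 wi; have [c c0 fluxP] := flux_modulus Psi_pen.
pose S := \sum_k w k.
have wS : w i <= S by rewrite /S (bigD1 i)//= lerDl sumr_ge0.
(* With this [e], the gain [w i * c] exceeds the total loss [2 * e * S] by exactly [e]. *)
pose e := w i * c / (2 * S + 1).
have S1 : 0 < 2 * S + 1 by lra.
have eE : e * (2 * S + 1) = w i * c by rewrite /e divfK// gt_eqF.
have e0 : 0 < e by rewrite divr_gt0 ?mulr_gt0.
have ec : e <= c.
  by rewrite ler_pdivrMr// mulrC ler_pM2l//; lra.
have [d d0 [fluxc flux_unif]] := fluxP e e0.
exists d => // x a b x01 a0 b1 /andP[ab abd] xi.
(* The effect of particle [k], per unit weight, on the difference of the drifts. *)
pose r k := flux Psi (x k - b) - flux Psi (x k - a)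
            + (flux Psi (x k + a) - flux Psi (x k + b)).
have refl k : - e < flux Psi (x k + a) - flux Psi (x k + b).
  have xk := x01 k.
  have : `|flux Psi (x k + a) - flux Psi (x k + b)| < e.
    apply: flux_unif; [lra|lra|].
    by rewrite (_ : x k + a - (x k + b) = - (b - a)) ?normrN ?gtr0_norm//; ring.
  by rewrite ltr_norml => /andP[].
have core s : 0 < s < d -> flux Psi s < e - c.
  by move=> /fluxc; rewrite ltr_norml; lra.
(* A particle at one end does not act on itself, as [flux Psi 0 = 0], and drives the other end away
   at rate more than [c - e]; the terms in [x k + a] and [x k + b] cost less than [e]. *)
have r_at k : x k = a \/ x k = b -> c - 2 * e < r k.
  have ba : 0 < b - a < d by rewrite ab.
  have := core _ ba; have := refl k; rewrite /r => rk cba [xk|xk].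
  - have -> : flux Psi (x k - b) = - flux Psi (b - a).
      by rewrite -fluxN; congr flux; lra.
    have -> : x k - a = 0 by lra.
    by rewrite {2}/flux mulr0; lra.
  - have -> : x k - b = 0 by lra.
    have -> : x k - a = b - a by lra.
    by rewrite {1}/flux mulr0; lra.
have r_ge k : - (2 * e) < r k.
  have xk := x01 k; have rk := refl k.
  have near s u : 0 < s < 2 -> 0 < u < 2 -> s - u = b - a ->
      `|flux Psi s - flux Psi u| < e.
    by move=> s0 u0 su; apply: flux_unif => //; rewrite su gtr0_norm.
  (* Outside [[a, b]] the terms in [x k - a] and [x k - b] nearly cancel; strictly inside, both ends
     are pushed away and the gain exceeds [2 * (c - e)]. *)
  have [xa|ax|xa] := ltgtP (x k) a; last by have := r_at k (or_introl xa); lra.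
  - have := near (b - x k) (a - x k); rewrite ltr_norml /r.
    rewrite -[x k - b]opprB -[x k - a]opprB !fluxN => H.
    by have /andP[] := H ltac:(lra) ltac:(lra) ltac:(ring); lra.
  - have [xb|bx|xb] := ltgtP (x k) b; last by have := r_at k (or_intror xb); lra.
    + have s1 : 0 < b - x k < d by lra.
      have s2 : 0 < x k - a < d by lra.
      have := core _ s1; have := core _ s2.
      by rewrite /r -[x k - b]opprB fluxN; lra.
    + have := near (x k - a) (x k - b); rewrite ltr_norml /r => H.
      by have /andP[] := H ltac:(lra) ltac:(lra) ltac:(ring); lra.
have ri := r_at i xi.
rewrite -subr_gt0 /drift -sumrB.
have -> : \sum_k (w k * (flux Psi (x k - b) - flux Psi (x k + b))
    - w k * (flux Psi (x k - a) - flux Psi (x k + a))) = \sum_k w k * r k.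
  by apply: eq_bigr => k _; rewrite /r; ring.
(* Every particle is charged [2 * e], and only [i] is credited with [c]. *)
have : \sum_k w k * (- (2 * e) + (k == i)%:R * c) <= \sum_k w k * r k.
  apply: ler_sum => k _; apply: ler_wpM2l => //.
  by case: eqP => [->|_]; [rewrite mul1r|rewrite mul0r addr0]; have := r_ge k; lra.
apply: lt_le_trans.
under eq_bigr do rewrite mulrDr.
rewrite big_split /= -mulr_suml -/S (bigD1 i)//= eqxx mul1r big1.
  by nra.
by move=> k /negPf ->; rewrite mul0r mulr0.
Qed.

(** * Preservation of the initial order of particles and walls *)

Theorem theorem4 (R : realType) (N : nat) (W : 'M[R]_N) (Psi : R -> R)
    (b : itv_bound R) (v : 'I_N -> R -> R)
    (Wge0 : forall i j : 'I_N, 0 <= W i j)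
    (Psi_penaliser : penaliser Psi)
    (v_init : forall i : 'I_N, 0 < v i 0 < 1)
    (v_init_distinct : forall i j : 'I_N, i != j -> v i 0 != v j 0)
    (v_evolves : evolves W Psi (Interval (BLeft 0) b) v)
    (W_cond : forall i j k : 'I_N, i != j -> W j k = W i k /\ 0 < W i k) :
  forall (i j : 'I_N) (t : R),
    t \in Interval (BLeft 0) b -> i != j -> v i t != v j t.
Proof.
have [v_cont v_derive] := v_evolves.
move=> i j t tJ ij.
have t0 : 0 <= t by move: tJ; rewrite itv_boundlr => /andP[].
have sub_J s : 0 <= s <= t -> s \in Interval (BLeft 0) b.
  move=> /andP[s0 st]; move: tJ; rewrite !itv_boundlr => /andP[_ tb].
  by rewrite bnd_simp s0 /= (le_trans _ tb)// bnd_simp.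
have int_J s : 0 < s < t -> [set` Interval (BLeft 0) b]^° s.
  move=> st; have : s \in `]0, t[ by rewrite in_itv.
  move=> /near_in_itvoo; apply: filterS => u; rewrite in_itv /= => ut.
  by apply: sub_J; lra.
have w_gt0 k : 0 < W i k by have [] := W_cond i j k ij.
(* All rows of [W] equal row [i], so a single [drift] moves every particle. *)
have w_eq k l : W k l = W i l.
  by have [->//|ik] := eqVneq i k; have [] := W_cond i k l ik.
(* Particles together with the walls 0 and 1. *)
pose p (a : 'I_N + bool) (s : R) : R :=
  match a with inl k => v k s | inr wall => wall%:R end.
pose x s k := v k s.
pose Q := [pred ac : ('I_N + bool) * ('I_N + bool) | p ac.1 0 < p ac.2 0].
pose g (ac : ('I_N + bool) * ('I_N + bool)) s := p ac.2 s - p ac.1 s.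
have p_cont a : {within `[0, t], continuous (p a)}.
  case: a => [k|wall]; last by apply: continuous_subspaceT => u; exact: cvg_cst.
  apply: continuous_subspaceW (v_cont k) => u; rewrite /= in_itv /=; exact: sub_J.
have p_derive s a : 0 < s < t -> (forall k, 0 < v k s < 1) ->
    is_derive s 1 (p a) (drift Psi (W i) (x s) (p a s)).
  move=> st v01; case: a => [k|[]].
  - have := v_derive k s (int_J s st); rewrite velocity_drift /=.
    by rewrite (_ : W k = W i)//; apply/funext => l; exact: w_eq.
  - by rewrite /= drift1//; exact: is_derive_cst.
  - by rewrite /= drift0//; exact: is_derive_cst.
have gap : forall ac s, Q ac -> 0 <= s <= t -> 0 < g ac s.
  apply: barrier.
  - move=> ac _ u; apply: cvgB; exact: p_cont.
  - by move=> ac; rewrite /g subr_gt0.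
  move=> [a c] /= Qac.
  suff [d d0 dP] : exists2 d : R, 0 < d & forall s, (forall k, 0 < v k s < 1) ->
      0 < g (a, c) s < d ->
      drift Psi (W i) (x s) (p a s) < drift Psi (W i) (x s) (p c s).
    exists d => // s st g_gt0 gd.
    (* The gaps to both walls belong to the family, so confinement at time [s] comes from the
       positivity that [barrier] lets one assume. *)
    have v01 k : 0 < v k s < 1.
      have /andP[vk0 vk1] := v_init k.
      have := g_gt0 (inr false, inl k) vk0; have := g_gt0 (inl k, inr true) vk1.
      by rewrite /g /=; lra.
    exists (drift Psi (W i) (x s) (p c s) - drift Psi (W i) (x s) (p a s)).
      by apply: is_deriveB; exact: p_derive.
    by rewrite subr_gt0; apply: dP => //; rewrite gd g_gt0.
  have p01 s e : (forall k, 0 < v k s < 1) -> 0 <= p e s <= 1.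
    by move=> v01; case: e => [k|[]] /=; [have := v01 k; lra|lra|lra].
  (* For a gap with at least one particle [k] at an end, the weight [W i k > 0] supplies the
     repulsion. *)
  have spread k : (forall s, v k s = p a s \/ v k s = p c s) ->
      exists2 d : R, 0 < d & forall s, (forall k, 0 < v k s < 1) ->
      0 < g (a, c) s < d ->
      drift Psi (W i) (x s) (p a s) < drift Psi (W i) (x s) (p c s).
    move=> vk.
    have [d d0 dP] := drift_spread Psi_penaliser (fun k => ltW (w_gt0 k)) (w_gt0 k).
    exists d => // s v01 gd; apply: dP => //.
    - by have /andP[] := p01 s a v01.
    - by have /andP[] := p01 s c v01.
    - exact: vk.
  move: a c => [k|wa] [l|wc] in Qac spread *.
  - by apply: (spread k); left.
  - by apply: (spread k); left.
  - by apply: (spread l); right.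
  (* Between the two walls the gap is constantly 1, hence never below the threshold 1. *)
  exists 1 => // s _; rewrite /g /= {spread}; move: Qac; rewrite /Q /=.
  by case: wa; case: wc; rewrite /=; lra.
have tt : 0 <= t <= t by rewrite t0 lexx.
have := v_init_distinct i j ij; rewrite neq_lt => /orP[vij|vji].
- by have := gap (inl i, inl j) t vij tt; rewrite /g /= subr_gt0 neq_lt => ->.
- by have := gap (inl j, inl i) t vji tt; rewrite /g /= subr_gt0 neq_lt orbC => ->.
Qed.
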